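(* For each $r\in\{0,1,2,3\}$ one has $$n_r^{\mathrm{first}}=1+\frac{r(r+1)}{2},\qquad \mathcal{F}_r=\mathcal{S}_r.$$ Explicitly, $$\mathcal{F}_0=\{(1)\},\qquad \mathcal{F}_1=\{(2),(1,1)\},\qquad \mathcal{F}_2=\{(3,1),(2,2),(2,1,1)\},$$ $$\mathcal{F}_3=\{(4,2,1),(3,3,1),(3,2,2),(3,2,1,1)\}.$$ In particular, $n_0^{\mathrm{first}}=1$, $n_1^{\mathrm{first}}=2$, $n_2^{\mathrm{first}}=4$, $n_3^{\mathrm{first}}=7$.
   Context: $\mathrm{Par}(n)$ is the set of integer partitions of $n$; $\lambda\vdash n$ means $\lambda\in\mathrm{Par}(n)$. The partition graph $G_n$ is the simple graph with vertex set $\mathrm{Par}(n)$ in which two distinct partitions are adjacent if one is obtained from the other by an elementary transfer of one unit between two parts (decrease one part by $1$ and increase another part by $1$, where the increased part may be an empty part of size $0$, i.e. a new part of size $1$ may be created, and a part that becomes $0$ is deleted), followed by reordering. $K_n$ is the clique complex of $G_n$: its simplices are the nonempty cliques $\sigma$ of $G_n$, with $\dim\sigma=|\sigma|-1$. The local simplex dimension of $\lambda\vdash n$ is $\mathrm{dim}_{\mathrm{loc}}(\lambda)=\max\{\dim\sigma:\sigma\text{ a simplex of }K_n,\ \lambda\in\sigma\}$. For $r\ge 0$ the $r$-th simplex layer is $L_r(n)=\{\lambda\vdash n:\mathrm{dim}_{\mathrm{loc}}(\lambda)=r\}$. The first-occurrence index is $n_r^{\mathrm{first}}=\min\{n\ge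 1: L_r(n)\neq\varnothing\}$ (when this minimum exists), and the first-occurrence set is $\mathcal{F}_r=L_r(n_r^{\mathrm{first}})$. For $r\ge 1$ let $\delta_r=(r,r-1,\dots,2,1)$ be the staircase partition, of size $r(r+1)/2$, and let $\mathcal{S}_r$ be the set of partitions obtained from $\delta_r$ by adding a single cell at an addable corner of its Young diagram (a cell outside the diagram whose addition gives a Young diagram). For $r=0$ set $\delta_0=\varnothing$ and $\mathcal{S}_0=\{(1)\}$. *)

(* Defs.v *)
From HB Require Import structures.
From mathcomp Require Import all_boot.
From mathcomp Require Import boolp classical_sets.

Set Implicit Arguments.
Unset Strict Implicit.
Unset Printing Implicit Defensive.

Local Open Scope nat_scope.
Local Open Scope classical_set_scope.

Definition is_part (n : nat) : pred (seq nat) :=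
  fun s => [&& sorted geq s, 0 \notin s & sumn s == n].

Record Par (n : nat) : Type := MkPar {
  parts :> seq nat;
  partsP : is_part n parts }.

HB.instance Definition _ n := [isSub for @parts n].
HB.instance Definition _ n := [Countable of Par n by <:].

(* A partition of n has at most n parts, all at most n; this bound is only used
   to equip [Par n] with a finType structure. *)
Definition Par_code n (p : Par n) : {bseq n of 'I_n.+1} :=
  insub_bseq n [seq inord x | x <- p].

Definition Par_decode n (b : {bseq n of 'I_n.+1}) : option (Par n) :=
  insub [seq val x | x <- b].

Lemma Par_codeK n : pcancel (@Par_code n) (@Par_decode n).
Proof.
case=> s sP; rewrite /Par_decode /Par_code /=.
have /and3P[_ s0 /eqP sn] := sP.
have size_le : size s <= n.
  rewrite -{}sn; elim: s {sP} s0 => //= x s IHs.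
  by rewrite inE negb_or eq_sym -lt0n => /andP[x0 /IHs]; exact: (@leq_add 1).
have part_le x : x \in s -> x <= n.
  rewrite -{}sn => {sP s0 size_le}; elim: s => //= y s IHs.
  rewrite inE => /predU1P[->|/IHs xs]; first exact: leq_addr.
  exact: leq_trans xs (leq_addl _ _).
rewrite /insub_bseq insubdK ?unfold_in /= ?size_map //.
rewrite -map_comp map_id_in => [|x /part_le xn]; last by rewrite /= inordK.
by rewrite (insubT (is_part n) sP); congr Some; apply: val_inj.
Qed.

HB.instance Definition _ n :=
  isFinite.Build (Par n) (pcan_enumP (@Par_codeK n)).

(* Move one unit from the i-th part to the j-th part, erase a possible zero part
   and reorder.  The index j = size s stands for an empty part. *)
Definition transfer (s : seq nat) (i j : nat) : seq nat :=
  sort geq [seq x <- mkseq (fun k => nth 0 s k + (k == j) - (k == i))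
                           (size s).+1 | x != 0].

Definition transfers_to (s t : seq nat) : bool :=
  [exists i : 'I_(size s), exists j : 'I_(size s).+1,
    (val i != val j) && (t == transfer s i j)].

Definition adj n : rel (Par n) := fun lam mu =>
  (lam != mu) && (transfers_to lam mu || transfers_to mu lam).

Definition clique n (sigma : {set Par n}) : bool :=
  [forall lam in sigma, forall mu in sigma, (lam != mu) ==> adj lam mu].

Definition simplex n (sigma : {set Par n}) : bool :=
  (sigma != finset.set0) && clique sigma.

Definition simplex_dim n (sigma : {set Par n}) : nat := #|sigma|.-1.

(* The range is never empty: it contains the singleton of lam. *)
Definition dim_loc n (lam : Par n) : nat :=
  \max_(sigma : {set Par n} | simplex sigma && (lam \in sigma))
     simplex_dim sigma.

Definition layer (r n : nat) : {set Par n} :=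
  [set lam : Par n | dim_loc lam == r]%SET.

(* The minimum, when it exists, is at least 1; the default value 0 thus means
   that no layer L_r(n) with n >= 1 is inhabited. *)
Definition n_first (r : nat) : nat :=
  xget 0 [set n | [/\ 0 < n, layer r n != finset.set0 &
    forall m, 0 < m -> layer r m != finset.set0 -> n <= m]].

Definition first_set (r : nat) : set (seq nat) :=
  @parts (n_first r) @` [set` layer r (n_first r)].

Definition staircase (r : nat) : seq nat := rev (iota 1 r).

Definition young (s : seq nat) : pred (nat * nat) :=
  fun c => c.2 < nth 0 s c.1.

(* t is a partition (of any integer) whose diagram is that of s plus one cell. *)
Definition adds_cell (s t : seq nat) : Prop :=
  is_part (sumn t) t /\
  exists2 c, ~~ young s c & young t =1 predU1 c (young s).

Definition staircase_succ (r : nat) : set (seq nat) :=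
  if r is 0 then [set [:: 1]] else [set t | adds_cell (staircase r) t].

(* Main.v *)
(* Only partitions of n <= 7 matter, so a finite computation suffices: dim_loc lam
   is the largest size of a clique among the neighbours of lam, because adding lam
   to such a clique gives a simplex through lam.  That size is found by branching
   on whether each partition of n in turn belongs to the clique. *)

Require Import Defs.
From HB Require Import structures.
From mathcomp Require Import all_boot.
From mathcomp Require Import boolp classical_sets.

Set Implicit Arguments.
Unset Strict Implicit.
Unset Printing Implicit Defensive.

Local Open Scope nat_scope.
Local Open Scope classical_set_scope.

(** * Clique numbers by exhaustive search *)

(** The predicate [p] records the vertices still allowed, so the clique under construction need not
    be stored: choosing [x] restricts [p] to the neighbours of [x]. *)
Fixpoint clique_number (T : Type) (e : rel T) (p : pred T) (s : seq T) : nat :=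
  if s is x :: s' then
    if p x then
      maxn (clique_number e p s') (clique_number e (predI p (e x)) s').+1
    else clique_number e p s'
  else 0.

Lemma clique_number_map (T U : Type) (f : T -> U) (e : rel U) (p : pred U) s :
  clique_number e p (map f s) = clique_number (relpre f e) (preim f p) s.
Proof. by elim: s p => //= x s IHs p; rewrite !IHs. Qed.

Lemma eq_clique_number (T : Type) (e e' : rel T) (p p' : pred T) s :
  e =2 e' -> p =1 p' -> clique_number e p s = clique_number e' p' s.
Proof.
move=> ee'; elim: s p p' => //= x s IHs p p' pp'.
by rewrite pp' (IHs _ _ pp') (IHs _ (predI p' (e' x))) // => y /=; rewrite pp' ee'.
Qed.

(** By induction on [s]: if the head [x] lies in [A], the rest of [A] consists of neighbours of [x]
    and is counted in the second branch; otherwise [A] already lies in the tail. *)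
Lemma card_clique_le (T : finType) (e : rel T) (p : pred T) (s : seq T)
    (A : {set T}) :
  {subset A <= s} -> {in A, forall x, p x} ->
  {in A &, forall x y, x != y -> e x y} -> #|A| <= clique_number e p s.
Proof.
elim: s p A => [|x s IHs] p A As Ap Ae /=.
  by rewrite leqn0 cards_eq0 -finset.subset0; apply/fintype.subsetP => y /As.
have [xA|xA] := boolP (x \in A); last first.
  have As' : {subset A <= s}.
    by move=> y yA; have := As y yA; rewrite inE => /predU1P[yx|//]; rewrite -yx yA in xA.
  by case: ifP => _; rewrite ?leq_max IHs.
rewrite (Ap x xA) leq_max (cardsD1 x) xA add1n ltnS IHs ?orbT //.
- by move=> y /finset.setD1P[yx /As]; rewrite inE (negPf yx).
- by move=> y /finset.setD1P[yx yA] /=; rewrite Ap // Ae // eq_sym.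
- by move=> y z /finset.setD1P[_ yA] /finset.setD1P[_ zA]; apply: Ae.
Qed.

(** The search tests [e x y] only for [x] before [y] in the list, hence symmetry. Irreflexivity
    keeps [x] out of the clique built from its neighbours, even if [s] repeats [x], so the cardinal
    really grows by one. *)
Lemma clique_number_attained (T : finType) (e : rel T) (p : pred T) (s : seq T) :
  symmetric e -> irreflexive e ->
  exists A : {set T}, [/\ {in A, forall x, p x},
    {in A &, forall x y, x != y -> e x y} & #|A| = clique_number e p s].
Proof.
move=> eC eI; elim: s p => [|x s IHs] p /=.
  by exists finset.set0; split=> [y|y z|]; rewrite ?inE ?cards0.
have [A [Ap Ae cA]] := IHs p.
case: ifP => px; last by exists A.
have [B [Bp Be cB]] := IHs (predI p (e x)).
have [leAB|ltBA] := leqP (clique_number e p s) (clique_number e (predI p (e x)) s).+1;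
  last by exists A.
have xB : x \notin B by apply/negP => /Bp /=; rewrite eI andbF.
exists (x |: B)%SET; rewrite cardsU1 xB cB add1n; split=> // [y|y z].
  by case/finset.setU1P => [->//|/Bp /andP[]].
case/finset.setU1P => [->|yB] /finset.setU1P[->|zB]; rewrite ?eqxx //.
- by move=> _; case/andP: (Bp z zB).
- by move=> _; rewrite eC; case/andP: (Bp y yB).
- exact: Be.
Qed.

(** * Local dimension as a clique number *)

Lemma adj_sym n : symmetric (@adj n).
Proof. by move=> x y; rewrite /adj eq_sym orbC. Qed.

Lemma adj_irr n : irreflexive (@adj n).
Proof. by move=> x; rewrite /adj eqxx. Qed.

Lemma dim_locE n (lam : Par n) (s : seq (Par n)) :
  (forall mu, mu \in s) -> dim_loc lam = clique_number (@adj n) (adj lam) s.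
Proof.
move=> sP; apply/eqP; rewrite eqn_leq; apply/andP; split.
  apply/bigmax_leqP => A /andP[/andP[_ Ac] lamA].
  have Ae : {in A &, forall x y, x != y -> adj x y}.
    by move=> x y xA yA; move: Ac => /forall_inP/(_ x xA)/forall_inP/(_ y yA)/implyP.
  (* The [.-1] of the dimension accounts exactly for the removal of [lam]. *)
  rewrite /simplex_dim (cardsD1 lam) lamA /=; apply: card_clique_le => //.
  - by move=> x /finset.setD1P[xl xA]; apply: Ae; rewrite // eq_sym.
  - by move=> x y /finset.setD1P[_ xA] /finset.setD1P[_ yA]; apply: Ae.
have [A [Al Ae <-]] :=
  clique_number_attained (adj lam) s (@adj_sym n) (@adj_irr n).
have lamA : lam \notin A by apply/negP => /Al; rewrite adj_irr.
suff simplexA : simplex (lam |: A)%SET && (lam \in (lam |: A)%SET).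
  have := @leq_bigmax_cond _ (fun B : {set Par n} => simplex B && (lam \in B))
    (@simplex_dim n) _ simplexA.
  by rewrite {1}/simplex_dim cardsU1 lamA.
rewrite finset.setU11 andbT; apply/andP; split; first by apply/finset.set0Pn; exists lam; rewrite finset.setU11.
apply/forall_inP => x /finset.setU1P xA.
apply/forall_inP => y /finset.setU1P yA; apply/implyP.
case: xA yA => [->|xA] [->|yA]; rewrite ?eqxx //.
- by move=> _; apply: Al.
- by move=> _; rewrite adj_sym; apply: Al.
- exact: Ae.
Qed.

(** * Computable partitions, transfers and dimensions *)

(* The first argument is fuel. *)
Fixpoint compositions (k n : nat) : seq (seq nat) :=
  if k is k'.+1 then
    if n is 0 then [:: [::]]
    else [seq x :: t | x <- iota 1 n, t <- compositions k' (n - x)]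
  else [:: [::]].

(** Each part uses up at least one unit of the sum, so fuel bounding the sum cannot run out
    early. *)
Lemma mem_compositions k t :
  0 \notin t -> sumn t <= k -> t \in compositions k (sumn t).
Proof.
elim: k t => [|k IHk] [|x t] //=; rewrite inE negb_or eq_sym -lt0n => /andP[x0 t0].
  by rewrite leqn0 addn_eq0 -leqn0 leqNgt x0.
case: x x0 => // x _; rewrite addSn => le.
apply/allpairsPdep; exists x.+1, t; split=> //.
  by rewrite mem_iota /= add1n !ltnS leq_addr.
rewrite subSS addKn; apply: IHk => //.
exact: leq_trans (leq_addl x _) le.
Qed.

(** The filter, not the generation, imposes the ordering of parts; this is affordable since 7 has
    only 64 compositions. *)
Definition partitions n : seq (seq nat) :=
  [seq t <- compositions n n | is_part n t].

Lemma mem_partitions n t : (t \in partitions n) = is_part n t.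
Proof.
rewrite mem_filter andb_idr // => /and3P[_ t0 /eqP nt].
by rewrite -nt mem_compositions.
Qed.

(* [transfers_to] quantifies over ordinals, whose enumeration does not compute. *)
Definition transfers_seq (s t : seq nat) : bool :=
  has (fun i => has (fun j => (i != j) && (t == transfer s i j))
                    (iota 0 (size s).+1)) (iota 0 (size s)).

Lemma transfers_toE : transfers_to =2 transfers_seq.
Proof.
move=> s t; apply/existsP/hasP => [[i /existsP[j ij]]|[i]].
  exists (val i); first by rewrite mem_iota /=.
  by apply/hasP; exists (val j); rewrite // mem_iota /=.
rewrite mem_iota => si /hasP[j]; rewrite mem_iota => sj ij.
by exists (Ordinal si); apply/existsP; exists (Ordinal sj).
Qed.

Definition adj_seq : rel (seq nat) := fun s t =>
  (s != t) && (transfers_seq s t || transfers_seq t s).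

Definition dim_seq n (t : seq nat) : nat :=
  clique_number adj_seq (adj_seq t) (partitions n).

Lemma dim_loc_seq n (lam : Par n) : dim_loc lam = dim_seq n lam.
Proof.
have adjE (x y : Par n) : adj x y = adj_seq x y.
  by rewrite /adj /adj_seq !transfers_toE val_eqE.
(* Every listed sequence passes [insub], so [val] maps [s] back onto [partitions n], and the search
   on [Par n] becomes one on plain lists. *)
pose s : seq (Par n) := pmap insub (partitions n).
have sE : map val s = partitions n.
  rewrite (pmap_filter (insubK _)) -[RHS]filter_predT.
  by apply: eq_in_filter => t; rewrite mem_partitions => tP; rewrite insubT.
rewrite (@dim_locE _ _ s) => [|mu]; last first.
  by rewrite mem_pmap_sub /= mem_partitions; exact: partsP.
by rewrite /dim_seq -sE clique_number_map; apply: eq_clique_number => [x y|y]; rewrite adjE.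
Qed.

(** * Layers and first occurrence *)

Definition layer_seq r n := [seq t <- partitions n | dim_seq n t == r].

Lemma layer_image r n : @parts n @` [set` layer r n] = [set` layer_seq r n].
Proof.
apply/seteqP; split=> [_ [lam /= lamr <-]|t /=].
  by move: lamr; rewrite inE mem_filter dim_loc_seq mem_partitions => ->; exact: partsP.
rewrite mem_filter mem_partitions => /andP[tr tP].
by exists (MkPar tP) => //=; rewrite inE dim_loc_seq.
Qed.

Lemma layer_neq0 r n : (layer r n != finset.set0) = (layer_seq r n != [::]).
Proof.
apply/finset.set0Pn/idP => [[lam lamr]|].
  have : [set` layer_seq r n] (parts lam) by rewrite -layer_image; exists lam.
  by case: (layer_seq r n).
case E: (layer_seq r n) => [//|t s] _.
have : [set` layer_seq r n] t by rewrite /= E mem_head.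
by rewrite -layer_image => -[lam]; exists lam.
Qed.

(** The hypotheses make [n] a least positive index of a nonempty layer. Two such indices bound each
    other, so [xget] has a single candidate and its default 0 is not returned. *)
Lemma first_occurrence r n : 0 < n -> layer_seq r n != [::] ->
  all (fun m => layer_seq r m == [::]) (iota 1 n.-1) ->
  n_first r = n /\ first_set r = [set` layer_seq r n].
Proof.
move=> n0 rn /allP rlt.
have nmin m : 0 < m -> layer r m != finset.set0 -> n <= m.
  rewrite layer_neq0 => m0 rm; rewrite leqNgt; apply/negP => mn.
  by case/negP: rm; apply: rlt; rewrite mem_iota m0 add1n prednK.
suff nE : n_first r = n by split=> //; rewrite /first_set nE layer_image.
apply: xget_unique => [|m [m0 rm mmin]]; first by split; rewrite ?layer_neq0.
by apply/eqP; rewrite eqn_leq nmin // mmin // layer_neq0.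
Qed.

(** * Adding one cell to a Young diagram *)

Lemma size_le_nth0 (t : seq nat) i : 0 \notin t -> nth 0 t i = 0 -> size t <= i.
Proof. by move=> t0 ti; rewrite leqNgt; apply/negP => /(mem_nth 0); rewrite ti (negPf t0). Qed.

(** Without zero entries, the length is the first index at which [nth] reads the default 0, so the
    values determine the length too. *)
Lemma eq_nth_positive (s t : seq nat) :
  0 \notin s -> 0 \notin t -> nth 0 s =1 nth 0 t -> s = t.
Proof.
move=> s0 t0 st; apply: (@eq_from_nth _ 0) => [|i _]; last exact: st.
apply/eqP; rewrite eqn_leq; apply/andP.
by split; apply: size_le_nth0 => //; [rewrite st|rewrite -st]; rewrite nth_default.
Qed.

(** At [i = size s] a single part 1 is appended; a larger [i] would pad with zeros. *)
Lemma incr_nth_positive (s : seq nat) i :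
  0 \notin s -> i <= size s -> 0 \notin incr_nth s i.
Proof.
move=> s0 si; apply/(nthP 0) => -[j]; rewrite size_incr_nth nth_incr_nth => jlt.
move=> /eqP; rewrite addn_eq0 eqb0 => /andP[ij /eqP /(size_le_nth0 s0) sj].
case: (ltnP i) jlt => [_|_]; first by rewrite ltnNge sj.
by move=> ji; case/negP: ij; rewrite eqn_leq (leq_trans si sj).
Qed.

(** A new cell lengthens exactly one row by one, possibly the empty row of index [size s];
    sortedness of the result says that the corner is addable. *)
Lemma adds_cellP (s t : seq nat) : 0 \notin s ->
  adds_cell s t <->
  t \in [seq u <- [seq incr_nth s i | i <- iota 0 (size s).+1] | sorted geq u].
Proof.
move=> s0; rewrite mem_filter; split=> [[/and3P[ts t0 _] [[i j] sij st]]|].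
  rewrite ts andTb; rewrite -leqNgt /= in sij.
  have tE k l : (l < nth 0 t k) = ((k == i) && (l == j)) || (l < nth 0 s k).
    by have := st (k, l); rewrite /= /young /= xpair_eqE.
  have tn k : k != i -> nth 0 t k = nth 0 s k.
    move=> /negPf ki; have lt_ts l : (l < nth 0 t k) = (l < nth 0 s k) by rewrite tE ki.
    apply/eqP; rewrite eqn_leq; apply/andP.
    by split; rewrite leqNgt; [rewrite lt_ts ltnn|rewrite -lt_ts ltnn].
  (* The cell sits at the first free place of its row: otherwise row [i] of [t] would contain that
     place as a second new cell. *)
  have ij : j = nth 0 s i.
    apply/eqP; rewrite eqn_leq sij andbT leqNgt; apply/negP => sltj.
    have : nth 0 s i < nth 0 t i by apply: ltn_trans sltj _; rewrite tE !eqxx.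
    by rewrite tE ltnn orbF eqxx /= => /eqP sj; rewrite sj ltnn in sltj.
  have ti : nth 0 t i = (nth 0 s i).+1.
    apply/eqP; rewrite -ij eqn_leq; apply/andP; split; last by rewrite tE !eqxx.
    by rewrite leqNgt tE -ij eqxx /= gtn_eqF //= ltnNge leqnSn.
  (* Below row [size s], the new cell would leave that row of [t] empty, so [t] would have no row
     [i]. *)
  have is' : i <= size s.
    rewrite leqNgt; apply/negP => lt_s_i.
    have : size t <= size s.
      by apply: size_le_nth0; rewrite // tn ?nth_default // neq_ltn lt_s_i.
    move=> /leq_trans/(_ (ltnW lt_s_i)) lt_t_i.
    by rewrite nth_default in ti.
  apply/mapP; exists i; first by rewrite mem_iota.
  apply: eq_nth_positive; rewrite ?incr_nth_positive // => k.
  rewrite nth_incr_nth eq_sym; have [->|ki] := eqVneq k i; first by rewrite ti.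
  exact: tn.
move=> /andP[ts /mapP[i]]; rewrite mem_iota /= add0n ltnS => si tE; split.
  by rewrite /is_part ts eqxx tE incr_nth_positive.
exists (i, nth 0 s i); rewrite /young /= ?ltnn // => -[k l] /=.
rewrite tE nth_incr_nth xpair_eqE eq_sym; have [->|//] := eqVneq k i.
by rewrite add1n ltnS leq_eqVlt.
Qed.

Lemma staircase_succE r : 0 < r ->
  staircase_succ r = [set` [seq u <- [seq incr_nth (staircase r) i |
    i <- iota 0 (size (staircase r)).+1] | sorted geq u]].
Proof.
case: r => // r _; apply/seteqP.
have pos : 0 \notin staircase r.+1 by rewrite mem_rev mem_iota.
by split=> t /(adds_cellP t pos).
Qed.

(** * Computation of the four cases *)

(** The lists are in increasing lexicographic order, the one in which [compositions] generates them,
    because they are matched literally with [layer_seq]. *)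
Lemma first_layers :
  [/\ n_first 0 = 1 /\ first_set 0 = [set` [:: [:: 1]]],
      n_first 1 = 2 /\ first_set 1 = [set` [:: [:: 1; 1]; [:: 2]]],
      n_first 2 = 4 /\
        first_set 2 = [set` [:: [:: 2; 1; 1]; [:: 2; 2]; [:: 3; 1]]] &
      n_first 3 = 7 /\ first_set 3 =
        [set` [:: [:: 3; 2; 1; 1]; [:: 3; 2; 2]; [:: 3; 3; 1]; [:: 4; 2; 1]]]].
Proof.
split.
- have -> : [:: [:: 1]] = layer_seq 0 1 by vm_compute.
  by apply: first_occurrence; vm_compute.
- have -> : [:: [:: 1; 1]; [:: 2]] = layer_seq 1 2 by vm_compute.
  by apply: first_occurrence; vm_compute.
- have -> : [:: [:: 2; 1; 1]; [:: 2; 2]; [:: 3; 1]] = layer_seq 2 4 by vm_compute.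
  by apply: first_occurrence; vm_compute.
- have -> : [:: [:: 3; 2; 1; 1]; [:: 3; 2; 2]; [:: 3; 3; 1]; [:: 4; 2; 1]] =
    layer_seq 3 7 by vm_compute.
  by apply: first_occurrence; vm_compute.
Qed.

(** Adding cells from the top row downwards lists the partitions in the order opposite to
    [layer_seq], so the two lists agree only up to permutation. *)
Lemma perm_set_seq (T : eqType) (s t : seq T) :
  perm_eq s t -> [set` s] = [set` t].
Proof. by move=> /perm_mem st; apply/seteqP; split=> x /=; rewrite st. Qed.

Theorem theorem4p1 :
  (forall r : nat, r <= 3 ->
     n_first r = 1 + (r * (r + 1)) %/ 2 /\ first_set r = staircase_succ r) /\
  [/\ first_set 0 = [set [:: 1]],
      first_set 1 = [set [:: 2]; [:: 1; 1]],
      first_set 2 = [set [:: 3; 1]; [:: 2; 2]; [:: 2; 1; 1]] &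
      first_set 3 =
        [set [:: 4; 2; 1]; [:: 3; 3; 1]; [:: 3; 2; 2]; [:: 3; 2; 1; 1]]] /\
  [/\ n_first 0 = 1, n_first 1 = 2, n_first 2 = 4 & n_first 3 = 7].
Proof.
have [[n0 F0] [n1 F1] [n2 F2] [n3 F3]] := first_layers.
have set1E : [set` [:: [:: 1]]] = [set [:: 1]].
  by apply/seteqP; split=> t /=; rewrite inE => /eqP.
split; last split; last by [].
  case=> [|[|[|[|//]]]] _.
  - by rewrite n0 F0 set1E.
  - by rewrite n1 F1 staircase_succE //; split=> //; apply: perm_set_seq; vm_compute.
  - by rewrite n2 F2 staircase_succE //; split=> //; apply: perm_set_seq; vm_compute.
  - by rewrite n3 F3 staircase_succE //; split=> //; apply: perm_set_seq; vm_compute.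
rewrite F0 F1 F2 F3; split=> //.
- by apply/seteqP; split=> t /=; rewrite !inE; [case/orP => /eqP|case] => ->;
    rewrite ?eqxx ?orbT; auto.
- by apply/seteqP; split=> t /=; rewrite !inE;
    [case/or3P => /eqP|case=> [[]|]] => ->; rewrite ?eqxx ?orbT; auto.
- by apply/seteqP; split=> t /=; rewrite !inE;
    [case/or4P => /eqP|case=> [[[]|]|]] => ->; rewrite ?eqxx ?orbT; auto.
Qed.
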